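(* Let $P(z)\in\mathbb{C}[[z]]$ be a harmonic self-inverting formal power series. Then, for any $m\ge1$, $P^m$ is HN.
   Context: $z=(z_1,\dots,z_n)$, $\nabla P=(\partial P/\partial z_1,\dots,\partial P/\partial z_n)$. Harmonic means $\Delta P=0$ with $\Delta=\sum_{i=1}^n\partial^2/\partial z_i^2$. A series is HN (Hessian nilpotent) if its Hessian matrix is nilpotent. $o(P)$ is the smallest total degree of a monomial occurring in $P$. For $P\in\mathbb{C}[[z]]$ with $o(P)\ge2$ and Hessian matrix nilpotent at $z=0$, the formal map $F(z)=z-\nabla P(z)$ has a formal inverse under composition of the form $G(z)=z+\nabla Q(z)$ for a unique $Q\in\mathbb{C}[[z]]$ with $o(Q)\ge2$, called the inversion pair of $P$. A formal power series $P$ with $o(P)\ge2$ and $(\mathrm{Hes}\,P)(0)$ nilpotent is self-inverting if its inversion pair satisfies $Q=P$. *)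

(* Defs.v *)
From HB Require Import structures.
From mathcomp Require Import all_boot all_order all_algebra.
From mathcomp Require Import boolp reals complex mpoly.

Set Implicit Arguments.
Unset Strict Implicit.
Unset Printing Implicit Defensive.

Import GRing.Theory.

Local Open Scope ring_scope.

(** A power series in [R[[z_1, ..., z_n]]] is its family of coefficients.  It is
    wrapped in a record because the bare function type ['X_{1..n} -> R] would
    otherwise compete with pointwise ring structures. *)
Record mseries (n : nat) (R : comNzRingType) : Type :=
  MSeries { mscoef : 'X_{1..n} -> R }.

Section Ring.
Variables (n : nat) (R : comNzRingType).
Implicit Types (f g h : mseries n R) (m : 'X_{1..n}).

HB.instance Definition _ := gen_eqMixin (mseries n R).
HB.instance Definition _ := gen_choiceMixin (mseries n R).

Lemma mseriesP f g : (forall m, mscoef f m = mscoef g m) -> f = g.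
Proof. by case: f g => [f] [g] /= /funext ->. Qed.

Definition msadd f g := MSeries (fun m => mscoef f m + mscoef g m).
Definition msopp f := MSeries (fun m => - mscoef f m).
Definition mszero : mseries n R := MSeries (fun=> 0).
Definition msone : mseries n R := MSeries (fun m => (m == 0%MM)%:R).

(** Cauchy product; the range is the one used for polynomials in [mcoeffM]. *)
Definition msmul f g := MSeries (fun m =>
  \sum_(k : 'X_{1..n < (mdeg m).+1, (mdeg m).+1} | m == (k.1 + k.2)%MM)
     mscoef f k.1 * mscoef g k.2).

Lemma msaddA : associative msadd.
Proof. by move=> f g h; apply: mseriesP => m /=; rewrite addrA. Qed.

Lemma msaddC : commutative msadd.
Proof. by move=> f g; apply: mseriesP => m /=; rewrite addrC. Qed.

Lemma msadd0 : left_id mszero msadd.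
Proof. by move=> f; apply: mseriesP => m /=; rewrite add0r. Qed.

Lemma msaddN : left_inverse mszero msopp msadd.
Proof. by move=> f; apply: mseriesP => m /=; rewrite addNr. Qed.

HB.instance Definition _ :=
  GRing.isZmodule.Build (mseries n R) msaddA msaddC msadd0 msaddN.

(** Truncation to total degree [< d]; the ring laws are transported along it
    from [{mpoly R[n]}]. *)
Definition mstrunc (d : nat) f : {mpoly R[n]} :=
  \sum_(m : 'X_{1..n < d}) mscoef f m *: 'X_[m].

Lemma mcoeff_mstrunc d f m :
  (mdeg m < d)%N -> (mstrunc d f)@_m = mscoef f m.
Proof. exact: mcoeff_mpoly. Qed.

Lemma mscoefM_mpoly f g (p q : {mpoly R[n]}) m :
  (forall k, (mdeg k <= mdeg m)%N -> p@_k = mscoef f k) ->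
  (forall k, (mdeg k <= mdeg m)%N -> q@_k = mscoef g k) ->
  mscoef (msmul f g) m = (p * q)@_m.
Proof.
move=> pf qg; rewrite mcoeffM /=; apply: eq_bigr => -[k1 k2] _ /=.
by rewrite pf ?qg // -ltnS bmdeg.
Qed.

Lemma msmulC : commutative msmul.
Proof.
move=> f g; apply: mseriesP => m.
have tr h k : (mdeg k <= mdeg m)%N -> (mstrunc (mdeg m).+1 h)@_k = mscoef h k.
  by move=> le_km; rewrite mcoeff_mstrunc.
by rewrite (mscoefM_mpoly (tr f) (tr g)) (mscoefM_mpoly (tr g) (tr f)) mulrC.
Qed.

Lemma msmulA : associative msmul.
Proof.
move=> f g h; apply: mseriesP => m.
have tr f' k :
    (mdeg k <= mdeg m)%N -> (mstrunc (mdeg m).+1 f')@_k = mscoef f' k.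
  by move=> le_km; rewrite mcoeff_mstrunc.
have trM f1 f2 k : (mdeg k <= mdeg m)%N ->
    (mstrunc (mdeg m).+1 f1 * mstrunc (mdeg m).+1 f2)@_k
    = mscoef (msmul f1 f2) k.
  move=> le_km; apply/esym/mscoefM_mpoly => l le_lk; apply: tr;
    exact: leq_trans le_km.
by rewrite (mscoefM_mpoly (tr f) (trM g h)) (mscoefM_mpoly (trM f g) (tr h))
  mulrA.
Qed.

Lemma msmul1 : left_id msone msmul.
Proof.
move=> f; apply: mseriesP => m.
rewrite (@mscoefM_mpoly _ _ 1 (mstrunc (mdeg m).+1 f)).
- by rewrite mul1r mcoeff_mstrunc.
- by move=> k _; rewrite mcoeff1.
- by move=> k le_km; rewrite mcoeff_mstrunc.
Qed.

Lemma msmulD : left_distributive msmul msadd.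
Proof.
move=> f g h; apply: mseriesP => m /=; rewrite -big_split /=.
by apply: eq_bigr => k _; rewrite mulrDl.
Qed.

Lemma msone_neq0 : msone != 0.
Proof.
apply/eqP => /(congr1 (fun f => mscoef f 0%MM)) /= /eqP.
by rewrite eqxx oner_eq0.
Qed.

HB.instance Definition _ :=
  GRing.Zmodule_isComNzRing.Build (mseries n R)
    msmulA msmulC msmul1 msmulD msone_neq0.

End Ring.

Section Calculus.
Variables (n : nat) (R : comNzRingType).
Implicit Types (P Q : mseries n R) (F G : 'rV[mseries n R]_n).

(** [order_ge d P] is [d <= o(P)], where [o(P)] is the least total degree of a
    monomial occurring in [P], with the usual convention [o(0) = +oo]. *)
Definition order_ge (d : nat) P : Prop :=
  forall m : 'X_{1..n}, mscoef P m != 0 -> (d <= mdeg m)%N.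

Definition msvar (i : 'I_n) : mseries n R :=
  MSeries (fun m => (m == U_(i)%MM)%:R).

Definition msderiv (i : 'I_n) P : mseries n R :=
  MSeries (fun m => mscoef P (m + U_(i))%MM *+ (m i).+1).

Definition laplacian P : mseries n R := \sum_(i < n) msderiv i (msderiv i P).

Definition harmonic P : Prop := laplacian P = 0.

Definition gradient P : 'rV[mseries n R]_n := \row_(i < n) msderiv i P.

Definition hessian P : 'M[mseries n R]_n :=
  \matrix_(i < n, j < n) msderiv i (msderiv j P).

Definition hessian_at0 P : 'M[R]_n :=
  map_mx (fun f : mseries n R => mscoef f 0%MM) (hessian P).

Definition nilpotent_mx (S : pzRingType) (A : 'M[S]_n) : Prop :=
  exists k : nat, A ^+ k = 0.

Definition hessian_nilpotent P : Prop := nilpotent_mx (hessian P).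

(** Substitution [P(G_1, ..., G_n)], meaningful when every [G_i] has zero
    constant term: a monomial [k] of [P] with [mdeg k > mdeg m] then contributes
    nothing to the coefficient of [m], so that the sum below is the full one. *)
Definition mssubst P G : mseries n R :=
  MSeries (fun m =>
    \sum_(k : 'X_{1..n < (mdeg m).+1})
       mscoef P k * mscoef (\prod_(i < n) G 0 i ^+ k i) m).

(** Formal maps are row vectors of series, [fmap_comp F G] is [z |-> F(G(z))]. *)
Definition fmap_id : 'rV[mseries n R]_n := \row_(i < n) msvar i.

Definition fmap_comp F G : 'rV[mseries n R]_n :=
  map_mx (fun f => mssubst f G) F.

Definition formal_inverse F G : Prop :=
  fmap_comp F G = fmap_id /\ fmap_comp G F = fmap_id.

Definition inversion_pair P Q : Prop :=
  order_ge 2 Q /\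
  formal_inverse (fmap_id - gradient P) (fmap_id + gradient Q).

Definition self_inverting P : Prop :=
  [/\ order_ge 2 P, nilpotent_mx (hessian_at0 P) & inversion_pair P P].

End Calculus.

(* Main.v *)
Require Import Defs.
From HB Require Import structures.
From mathcomp Require Import all_boot all_order all_algebra.
From mathcomp Require Import reals complex mpoly.

Set Implicit Arguments.
Unset Strict Implicit.
Unset Printing Implicit Defensive.

Import GRing.Theory Num.Theory.

Local Open Scope ring_scope.

(** Put [N = grad P]. Self-inversion gives [N(z + N(z)) = N(z)], hence by
    iteration [N(z + k N(z)) = N(z)] for every natural [k]. Each coefficient is
    polynomial in [k], so it does not depend on [k] at all, and the linear term
    in [k] yields [(Hes P) N = 0], i.e. [<N, N>] has zero gradient and thus
    vanishes. Together with [Delta P = 0] this makes every power [f = P^m]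
    harmonic and isotropic, [<grad f, grad f> = 0]. For such an [f] with Hessian
    [H], differentiating [H grad f = 0] gives [D H = - H^2] for the derivation
    [D = sum_j (d_j f) d_j]; hence [D (tr H^k) = - k tr H^(k+1)], so all the
    traces of powers vanish, starting from [tr H = Delta f = 0], and [H] is
    nilpotent. *)

(** * Matrices all of whose powers are traceless *)

Lemma deriv_prod (R : comNzRingType) (I : finType) (F : I -> {poly R}) :
  (\prod_i F i)^`() = \sum_i (F i)^`() * \prod_(j | j != i) F j.
Proof.
have -> : (\prod_i F i)^`() =
    \sum_(i <- enum I) (F i)^`() * \prod_(j <- enum I | j != i) F j.
  rewrite -(big_enum _ _ xpredT) /=.
  elim: (enum I) (enum_uniq I) => [|i s IHs] /=;
    first by rewrite !big_nil derivC.
  case/andP=> i_s us; rewrite !big_cons derivM IHs // eqxx /=;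
    congr (_ * _ + _).
    rewrite big_seq_cond [in RHS]big_seq_cond; apply: eq_bigl => j.
    by case: (boolP (j \in s)) => //= js; apply/esym;
      apply: contraNneq i_s => <-.
  rewrite mulr_sumr big_seq [in RHS]big_seq; apply: eq_bigr => j js.
  rewrite big_cons; have -> /= : i != j by apply: contraNneq i_s => ->.
  by rewrite mulrCA.
by rewrite big_enum; apply: eq_bigr => i _; rewrite big_enum_cond.
Qed.

(** Jacobi's formula for ['X - A]. In each term of the Leibniz expansion, differentiating the factor
    of row [i] replaces that row by the [i]-th unit row, because ['X] occurs only on the diagonal;
    the determinant so obtained is the [i]-th diagonal cofactor. *)
Lemma deriv_char_poly (R : comNzRingType) (n : nat) (A : 'M[R]_n) :
  (char_poly A)^`() = \tr (\adj (char_poly_mx A)).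
Proof.
set B := char_poly_mx A.
have dB i j : (B i j)^`() = (i == j)%:R.
  by rewrite !mxE derivB derivC subr0 derivMn derivX.
rewrite /char_poly /determinant raddf_sum /mxtrace /=.
have dsign (b : bool) (q : {poly R}) : ((-1) ^+ b * q)^`() = (-1) ^+ b * q^`().
  by case: b; rewrite ?mul1r // expr1 !mulN1r derivN.
under eq_bigr => s _ do rewrite dsign deriv_prod mulr_sumr.
rewrite exchange_big /=; apply: eq_bigr => i _.
rewrite mxE.
pose B' := \matrix_(k, l) (if k == i then (l == i)%:R else B k l).
have -> : cofactor B i i = \det B'.
  rewrite (expand_det_row _ i) (bigD1 i) //= big1 ?addr0; last first.
    by move=> j /negbTE ji; rewrite mxE eqxx ji mul0r.
  rewrite mxE !eqxx mul1r /cofactor; congr (_ * \det _).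
  by apply/matrixP => k l;
    rewrite !mxE [lift i k == i]eq_sym (negbTE (neq_lift _ _)).
rewrite /determinant; apply: eq_bigr => s _; congr (_ * _).
rewrite [RHS](bigD1 i) //= [B' _ _]mxE eqxx dB eq_sym; congr (_ * _).
by apply: eq_bigr => j /negbTE ji; rewrite [B' _ _]mxE ji.
Qed.

(* Newton's identities, read off the coefficients of
   [('X - A) adj('X - A) = char_poly A] and of its trace. *)
Lemma char_poly_traceless (R : comNzRingType) (n : nat) (A : 'M[R]_n) :
  (forall (x : R) k, x *+ k.+1 = 0 -> x = 0) ->
  (forall k, \tr (A ^+ k.+1) = 0) -> char_poly A = 'X^n.
Proof.
move=> tf trA; pose p := char_poly A; pose B := \adj (char_poly_mx A).
(* Coefficient matrices of the adjugate, so that [B] is the sum of the [C l] times ['X^l]; comparing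
   coefficients gives the recursion [CS]. *)
pose C l : 'M[R]_n := \matrix_(i, j) (B i j)`_l.
have adjE i j : 'X * B i j - \sum_k (A i k)%:P * B k j = p *+ (i == j).
  have /matrixP/(_ i j) := mul_mx_adj (char_poly_mx A).
  rewrite -/B [(_ *m _) i j]mxE [_%:M i j]mxE -/(char_poly A) => <-.
  rewrite [RHS](eq_bigr (fun k => 'X *+ (i == k) * B k j - (A i k)%:P * B k j)).
    rewrite big_split sumrN /= [X in _ = X - _](bigD1 i) //= eqxx [X in _ = _ +
      X - _]big1 ?addr0 // => k.
    by rewrite eq_sym => /negbTE ->; rewrite mul0r.
  move=> k _;
    have -> : char_poly_mx A i k = 'X *+ (i == k) - (A i k)%:P by rewrite !mxE.
  by rewrite mulrBl.
have CE l i j : C l i j = (B i j)`_l by rewrite mxE.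
have AC l i j : (A *m C l) i j = \sum_k A i k * (B k j)`_l.
  by rewrite mxE; apply: eq_bigr => k _; rewrite CE.
have C0 : A *m C 0%N = - (p`_0)%:M.
  apply/matrixP => i j; rewrite AC [RHS]mxE mxE.
  have /(congr1 (fun q : {poly R} => - q`_0)) := adjE i j.
  rewrite coefB coefXM /= sub0r opprK coef_sum coefMn => <-.
  by apply: eq_bigr => k _; rewrite coefCM.
have CS l : C l = A *m C l.+1 + (p`_l.+1)%:M.
  apply/matrixP => i j; rewrite CE [RHS]mxE AC [X in _ = _ + X]mxE.
  have /(congr1 (fun q : {poly R} => q`_l.+1)) := adjE i j.
  rewrite coefB coefXM /= coef_sum coefMn => <-.
  by under [X in _ - X]eq_bigr => k _ do rewrite coefCM; rewrite addrC subrK.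
(* Downward induction on [l]: [C l] vanishes once [l] reaches the size of every entry of [B], and
   [d] bounds the distance to that point. *)
have trAC d : forall k l, (\max_i \max_j size (B i j) <= l + d)%N ->
    \tr (A ^+ k.+1 *m C l) = 0.
  elim: d => [|d IHd] k l le_ld.
    have -> : C l = 0; last by rewrite mulmx0 mxtrace0.
    apply/matrixP => i j; rewrite CE [RHS]mxE nth_default //.
    rewrite addn0 in le_ld; apply: leq_trans le_ld.
    apply: leq_trans (leq_bigmax (F := fun i => \max_j size (B i j)) i).
    exact: (leq_bigmax (F := fun j => size (B i j))).
  rewrite CS mulmxDr mxtraceD mulmxA mul_mx_scalar mxtraceZ trA mulr0 addr0.
  by rewrite -[A ^+ _ *m A]/(A ^+ k.+1 * A) -exprSr IHd // addSnnS.
have trAC0 l : \tr (A *m C l) = 0 by rewrite -[A]expr1 (trAC _ 0%N l (leq_addl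
  _ _)).
have pS l : (l < n)%N -> p`_l = 0.
  case: l => [|l] lt_ln.
    apply: (tf _ n.-1); rewrite prednK // -mxtrace_scalar.
    have -> : (p`_0)%:M = - (A *m C 0%N) by rewrite C0 opprK.
    by rewrite raddfN /= trAC0 oppr0.
  (* The coefficient of ['X^l] in Jacobi's formula is the trace of [C l], which [CS] reduces to [n]
     times [p_(l+1)]. As [l + 1 < n], the nonzero multiple [n - (l + 1)] kills [p_(l+1)]. *)
  have e1 : p`_l.+1 *+ l.+1 = p`_l.+1 *+ n.
    rewrite -coef_deriv deriv_char_poly -/B /mxtrace coef_sum.
    transitivity (\tr (C l)); first by apply: eq_bigr => i _; rewrite CE.
    by rewrite CS mxtraceD trAC0 add0r mxtrace_scalar.
  by apply: (tf _ (n - l.+1).-1);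
    rewrite prednK ?subn_gt0 // mulrnBr 1?ltnW // e1 subrr.
apply/polyP => l; rewrite coefXn.
have szp : size p = n.+1 := size_char_poly A.
case: (ltngtP l n) => [lt_ln|lt_nl|->].
- exact: pS.
- by rewrite nth_default // szp.
- by have /monicP := char_poly_monic A; rewrite lead_coefE szp.
Qed.

Lemma traceless_nilpotent (R : comNzRingType) (n : nat) (A : 'M[R]_n) :
  (forall (x : R) k, x *+ k.+1 = 0 -> x = 0) ->
  (forall k, \tr (A ^+ k.+1) = 0) -> A ^+ n = 0.
Proof.
case: n A => [|n] A tf trA; first by apply/matrixP => [[]].
have := Cayley_Hamilton A; rewrite char_poly_traceless //.
by rewrite rmorphXn /= horner_mx_X.
Qed.

(** * Derivations and substitution of power series *)

Section Series.
Variables (n : nat) (R : comNzRingType).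
Implicit Types (f g : mseries n R) (m : 'X_{1..n}) (p q : {mpoly R[n]}).

Definition mspoly p : mseries n R := MSeries (fun m => p@_m).

Lemma mspoly_is_additive : additive mspoly.
Proof. by move=> p q; apply: mseriesP => m /=; rewrite mcoeffB. Qed.

Lemma mspoly_is_multiplicative : multiplicative mspoly.
Proof.
split=> [p q|]; apply: mseriesP => m; last by rewrite /= mcoeff1.
by apply/esym/mscoefM_mpoly.
Qed.

HB.instance Definition _ :=
  GRing.isAdditive.Build {mpoly R[n]} (mseries n R) mspoly mspoly_is_additive.
HB.instance Definition _ :=
  GRing.isMultiplicative.Build {mpoly R[n]} (mseries n R) mspoly
    mspoly_is_multiplicative.

Lemma mspolyX i : mspoly 'X_i = msvar R i.
Proof. by apply: mseriesP => m; rewrite /= mcoeffX eq_sym. Qed.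

Lemma mscoef_sum (I : Type) (r : seq I) (P : pred I) (F : I -> mseries n R) m :
  mscoef (\sum_(i <- r | P i) F i) m = \sum_(i <- r | P i) mscoef (F i) m.
Proof. exact: (big_morph (fun f => mscoef f m)). Qed.

Lemma mscoefMn f k m : mscoef (f *+ k) m = mscoef f m *+ k.
Proof. by elim: k => // k IHk; rewrite !mulrS -IHk. Qed.

(** Congruence modulo terms of degree at least [d]. Identities of series are reduced, for each [d],
    to identities between polynomial truncations. *)
Definition eqms d f g := forall m, (mdeg m < d)%N -> mscoef f m = mscoef g m.

Lemma eqms_eq f g : (forall d, eqms d f g) -> f = g.
Proof. by move=> fg; apply: mseriesP => m; apply: fg (ltnSn _). Qed.

Lemma eqms_trunc d f : eqms d f (mspoly (mstrunc d f)).
Proof. by move=> m lt_md; rewrite /= mcoeff_mstrunc. Qed.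

Lemma eqmsM d f1 f2 g1 g2 :
  eqms d f1 g1 -> eqms d f2 g2 -> eqms d (f1 * f2) (g1 * g2).
Proof.
move=> fg1 fg2 m lt_md; apply: eq_bigr => -[k1 k2] _ /=.
by rewrite fg1 ?fg2 //; apply: leq_trans lt_md; rewrite ?bmdeg.
Qed.

Lemma order_geP d f : order_ge d f <-> eqms d f 0.
Proof.
split=> [oF m lt_md|f0 m].
  by apply/eqP; apply: contraTT lt_md => /oF; rewrite -leqNgt.
by rewrite leqNgt; apply: contraNN => /f0 ->.
Qed.

Lemma order_geM d e f g :
  order_ge d f -> order_ge e g -> order_ge (d + e) (f * g).
Proof.
move=> oF og; apply/order_geP => m lt_m.
rewrite [LHS]big1 // => -[k1 k2] /= /eqP/(congr1 mdeg) mE.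
have [->|/oF le_d] := eqVneq (mscoef f k1) 0; first by rewrite mul0r.
have [->|/og le_e] := eqVneq (mscoef g k2) 0; first by rewrite mulr0.
by have := leq_add le_d le_e; rewrite -mdegD -mE leqNgt lt_m.
Qed.

Lemma order_geX d f k : order_ge d f -> order_ge (k * d) (f ^+ k).
Proof.
by move=> oF; elim: k => [|k IHk] //; rewrite exprS mulSn; apply: order_geM.
Qed.

Lemma order_ge_sum d (I : Type) (r : seq I) (P : pred I)
    (F : I -> mseries n R) :
  (forall i, P i -> order_ge d (F i)) -> order_ge d (\sum_(i <- r | P i) F i).
Proof.
move=> oF; apply/order_geP => m lt_md; rewrite mscoef_sum big1 // => i Pi.
by have /order_geP := oF i Pi; apply.
Qed.

Lemma order_ge_mmap1 (h : 'I_n -> mseries n R) m :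
  (forall i, order_ge 1 (h i)) -> order_ge (mdeg m) (mmap1 h m).
Proof.
move=> oh; rewrite /mmap1 mdegE.
apply: (big_ind2 (fun f d => order_ge d f)) => //.
  by move=> *; apply: order_geM.
by move=> i _; rewrite -[X in order_ge X]muln1; apply: order_geX.
Qed.

Lemma mderiv_mspoly i p : msderiv i (mspoly p) = mspoly p^`M(i).
Proof. by apply: mseriesP => m; rewrite /= mcoeff_deriv. Qed.

Lemma eqms_deriv d i f g :
  eqms d.+1 f g -> eqms d (msderiv i f) (msderiv i g).
Proof. by move=> fg m lt_md; rewrite /= fg // mdegD mdeg1 addn1. Qed.

Lemma eqms_sym d f g : eqms d f g -> eqms d g f.
Proof. by move=> fg m /fg. Qed.

Lemma eqms_trans d f g h : eqms d f g -> eqms d g h -> eqms d f h.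
Proof. by move=> fg gh m lt_md; rewrite fg ?gh. Qed.

Lemma eqmsW d e f g : (d <= e)%N -> eqms e f g -> eqms d f g.
Proof. by move=> le_de fg m lt_md; apply: fg; apply: leq_trans le_de. Qed.

Lemma eqmsD d f1 f2 g1 g2 :
  eqms d f1 g1 -> eqms d f2 g2 -> eqms d (f1 + f2) (g1 + g2).
Proof. by move=> fg1 fg2 m lt_md; rewrite /= fg1 ?fg2. Qed.

Lemma msderiv_is_additive i : additive (@msderiv n R i).
Proof. by move=> f g; apply: mseriesP => m; rewrite /= mulrnBl. Qed.

HB.instance Definition _ i :=
  GRing.isAdditive.Build (mseries n R) (mseries n R) (@msderiv n R i)
    (msderiv_is_additive i).

Lemma msderivM i f g :
  msderiv i (f * g) = msderiv i f * g + f * msderiv i g.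
Proof.
apply: eqms_eq => d.
(* Differentiation loses one degree of precision, hence the truncation at [d.+1]. *)
have [tf tg] := (@eqms_trunc d.+1 f, @eqms_trunc d.+1 g).
apply: eqms_trans (eqms_deriv i (eqmsM tf tg)) _.
rewrite -rmorphM mderiv_mspoly mderivM rmorphD !rmorphM /= -!mderiv_mspoly.
have [tfd tgd] := (eqmsW (leqnSn d) tf, eqmsW (leqnSn d) tg).
by apply/eqms_sym/eqmsD; apply: eqmsM => //; apply: eqms_deriv.
Qed.

Lemma msderivC i j f : msderiv i (msderiv j f) = msderiv j (msderiv i f).
Proof.
apply: eqms_eq => d.
have tf := @eqms_trunc d.+2 f.
apply: eqms_trans (eqms_deriv _ (eqms_deriv _ tf)) _.
apply/eqms_sym; apply: eqms_trans (eqms_deriv _ (eqms_deriv _ tf)) _.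
by rewrite !mderiv_mspoly mderiv_comm.
Qed.

End Series.

Lemma rmorph_mmap (n : nat) (R : nzRingType) (S S' : nzRingType)
    (g : {rmorphism S -> S'}) (f : {additive R -> S}) (h : 'I_n -> S)
    (p : {mpoly R[n]}) :
  g (mmap f h p) = mmap (g \o f) (g \o h) p.
Proof.
rewrite /mmap rmorph_sum; apply: eq_bigr => m _; rewrite rmorphM /=.
by rewrite /mmap1 rmorph_prod; congr (_ * _); apply: eq_bigr => i _;
  rewrite rmorphXn.
Qed.

Section Subst.
Variables (n : nat) (R : comNzRingType) (G : 'rV[mseries n R]_n).
Hypothesis G0 : forall i, order_ge 1 (G 0 i).
Implicit Types (f g : mseries n R) (m : 'X_{1..n}) (p q : {mpoly R[n]}).

Definition msconst : {rmorphism R -> mseries n R} :=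
  (@mspoly n R : {rmorphism _ -> _}) \o (@mpolyC n R : {rmorphism _ -> _}).

Lemma mscoef_constM c f m : mscoef (msconst c * f) m = c * mscoef f m.
Proof.
have cf : eqms (mdeg m).+1 (msconst c * f)
    (mspoly (c%:MP_[n] * mstrunc (mdeg m).+1 f)).
  by rewrite rmorphM; apply: eqmsM => //; apply: eqms_trunc.
by rewrite cf // /= mcoeffCM mcoeff_mstrunc.
Qed.

(** Polynomial evaluation at [G] inside the ring of series. It is a ring morphism, and [mssubst]
    inherits its algebraic laws by truncation. *)
Definition mseval p : mseries n R := mmap msconst (G 0) p.

Lemma mssubst_trunc f m :
  mscoef (mssubst f G) m = mscoef (mseval (mstrunc (mdeg m).+1 f)) m.
Proof.
rewrite /mseval /mstrunc raddf_sum mscoef_sum /=; apply: eq_bigr => k _.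
by rewrite mmapZ mmapX mscoef_constM.
Qed.

(** Each component of [G] has zero constant term, so a monomial of degree [e] evaluates to a series
    of order at least [e]. *)
Lemma order_ge_mseval d p : eqms d (mspoly p) 0 -> eqms d (mseval p) 0.
Proof.
move=> p0; apply/order_geP/order_ge_sum => m _.
have [le_dm|/p0 /= ->] := leqP d (mdeg m); last first.
  by rewrite rmorph0 mul0r; apply/order_geP.
rewrite -[d]add0n; apply: order_geM; first by [].
by move=> k /(order_ge_mmap1 G0); apply: leq_trans.
Qed.

Lemma mssubst_eqms d f p :
  eqms d f (mspoly p) -> eqms d (mssubst f G) (mseval p).
Proof.
move=> fp m lt_md; rewrite mssubst_trunc; apply/eqP; rewrite -subr_eq0;
  apply/eqP.
set q := mstrunc _ _.
have /(_ m (ltnSn _)) /= <- : eqms (mdeg m).+1 (mseval (q - p)) 0;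
  last by rewrite /mseval raddfB.
apply: order_ge_mseval => k lt_km.
by rewrite /= mcoeffB mcoeff_mstrunc // fp ?subrr // (leq_trans lt_km).
Qed.

Lemma mssubst_mspoly p : mssubst (mspoly p) G = mseval p.
Proof. by apply: eqms_eq => d; apply: mssubst_eqms. Qed.

Lemma mssubst_is_additive : additive (fun f => mssubst f G).
Proof.
move=> f g; apply: eqms_eq => d.
have [tf tg] := (@eqms_trunc _ _ d f, @eqms_trunc _ _ d g).
apply: (eqms_trans (mssubst_eqms (p := mstrunc d f - mstrunc d g) _)).
  by move=> m lt_md; rewrite /= mcoeffB !mcoeff_mstrunc //; reflexivity.
by move=> m lt_md;
  rewrite /mseval raddfB /= -(mssubst_eqms tf) // -(mssubst_eqms tg).
Qed.

Lemma mssubst_is_multiplicative : multiplicative (fun f => mssubst f G).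
Proof.
split=> [f g|]; last by have := mssubst_mspoly 1;
  rewrite rmorph1 /mseval rmorph1.
apply: eqms_eq => d.
have [tf tg] := (@eqms_trunc _ _ d f, @eqms_trunc _ _ d g).
apply: (eqms_trans (mssubst_eqms (p := mstrunc d f * mstrunc d g) _)).
  by rewrite rmorphM; apply: eqmsM.
by rewrite /mseval rmorphM; apply/eqms_sym/eqmsM; apply: mssubst_eqms.
Qed.

Lemma mssubst_local d f g : eqms d f g -> eqms d (mssubst f G) (mssubst g G).
Proof.
move=> fg; have tg := @eqms_trunc _ _ d g.
apply: eqms_trans (mssubst_eqms (eqms_trans fg tg)) _.
exact/eqms_sym/mssubst_eqms.
Qed.

End Subst.

(** * Polynomials evaluated along a line *)

Lemma mpoly_ring_ind (n : nat) (R : comNzRingType) (T : {mpoly R[n]} -> Prop) :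
  (forall c, T c%:MP) -> (forall i, T 'X_i) ->
  (forall p q, T p -> T q -> T (p + q)) ->
  (forall p q, T p -> T q -> T (p * q)) -> forall p, T p.
Proof.
move=> TC TX TD TM p; rewrite [p]mpolyE; apply: big_ind => //.
  by rewrite -mpolyC0.
move=> m _; rewrite -mul_mpolyC mpolyXE_id; apply: (TM) => //.
apply: big_ind => //; first by rewrite -mpolyC1.
move=> i _; elim: (m i) => [|k IHk]; first by rewrite expr0 -mpolyC1.
by rewrite exprS; apply: TM.
Qed.

(** Chain rule at [T = 0] for the line [h + T v]. Both sides satisfy the Leibniz rule over
    evaluation at [h], so agreement on constants and variables suffices. *)
Lemma deriv_mmap_line (n : nat) (R S : comNzRingType) (f : {rmorphism R -> S})
    (h v : 'I_n -> S) (p : {mpoly R[n]}) :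
  (mmap (polyC \o f) (fun i => (h i)%:P + (v i)%:P * 'X) p)^`().[0]
  = \sum_j v j * mmap f h p^`M(j).
Proof.
set e := mmap _ _.
have e0 q : (e q).[0] = mmap f h q.
  elim/mpoly_ring_ind: q => [c|i|q1 q2 IH1 IH2|q1 q2 IH1 IH2].
  - by rewrite /e !mmapC hornerC.
  - by rewrite /e !mmapX !mmap1U !hornerE.
  - by rewrite /e !mmapD hornerD IH1 IH2.
  - by rewrite /e !rmorphM hornerM IH1 IH2.
elim/mpoly_ring_ind: p => [c|i|q1 q2 IH1 IH2|q1 q2 IH1 IH2].
- rewrite /e mmapC derivC hornerC big1 // => j _.
  by rewrite mderivC mmap0 mulr0.
- rewrite /e mmapX mmap1U derivD derivM !derivC derivX !hornerE.
  rewrite (bigD1 i) //= big1 => [|j ji].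
    rewrite mderivX mnm1E eqxx scale1r -[X in (X - _)%MM]add0m addmK.
    by rewrite mpolyX0 rmorph1 mulr1 addr0.
  by rewrite mderivX mnm1E eq_sym (negbTE ji) scale0r mmap0 mulr0.
- rewrite /e mmapD derivD hornerD IH1 IH2 -big_split /=; apply: eq_bigr => j _.
  by rewrite mderivD mmapD mulrDr.
- rewrite /e rmorphM derivM hornerD !hornerM -/e !e0 IH1 IH2.
  rewrite mulr_suml mulr_sumr -big_split /=; apply: eq_bigr => j _.
  by rewrite mderivM mmapD !rmorphM mulrDr -mulrA (mulrCA (mmap f h q1)).
Qed.

Lemma mseval_id (n : nat) (R : comNzRingType) (p : {mpoly R[n]}) :
  mseval (fmap_id n R) p = mspoly p.
Proof.
elim/mpoly_ring_ind: p => [c|i|q1 q2 IH1 IH2|q1 q2 IH1 IH2].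
- by rewrite /mseval mmapC.
- by rewrite /mseval mmapX mmap1U mxE mspolyX.
- by rewrite rmorphD /= -IH1 -IH2 /mseval rmorphD.
- by rewrite rmorphM /= -IH1 -IH2 /mseval rmorphM.
Qed.

(** * Isotropic and self-inverting series *)

(** Natural numbers are pairwise distinct in [K], so [p - c] has more roots than its degree
    allows. *)
Lemma poly_const_on_nat (K : numDomainType) (p : {poly K}) (c : K) :
  (forall k : nat, p.[k%:R] = c) -> p = c%:P.
Proof.
move=> pc; apply/eqP; rewrite -subr_eq0; apply/eqP.
set q := p - c%:P.
apply: (@roots_geq_poly_eq0 _ q [seq k%:R | k <- iota 0 (size q)]).
- apply/allP => _ /mapP[k _ ->]; apply/eqP.
  by rewrite /q !hornerE pc subrr.
- by rewrite map_inj_uniq ?iota_uniq // => k l /eqP; rewrite eqr_nat => /eqP.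
- by rewrite size_map size_iota.
Qed.

Section Char0.
Variables (n : nat) (K : numDomainType).
Implicit Types (f P : mseries n K).

Lemma mseries_torsion_free f k : f *+ k.+1 = 0 -> f = 0.
Proof.
move=> fk; apply: mseriesP => m; have := congr1 (fun g => mscoef g m) fk.
by rewrite mscoefMn => /eqP; rewrite mulrn_eq0 => /eqP.
Qed.

(** A coefficient at a nonconstant monomial reappears, up to a positive integer factor, in the
    derivative along any variable dividing that monomial. *)
Lemma msderiv_eq0 f :
  (forall i, msderiv i f = 0) -> mscoef f 0%MM = 0 -> f = 0.
Proof.
move=> df f0; apply: mseriesP => m; have [->|m_neq0] := eqVneq m 0%MM;
  first exact: f0.
have [i mi] : exists i, m i != 0%N.
  apply/existsP; apply: contraNT m_neq0; rewrite negb_exists => /forallP m0.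
  by apply/eqP/mnmP => i; rewrite mnm0E; apply/eqP; have := m0 i; rewrite negbK.
have Um : (U_(i) <= m)%MM by rewrite lep1mP.
have /eqP := congr1 (fun g => mscoef g (m - U_(i))%MM) (df i).
by rewrite /= submK // mulrn_eq0 => /eqP.
Qed.

Lemma order_ge_shift (N : 'rV[mseries n K]_n) :
  (forall j, order_ge 1 (N 0 j)) ->
  forall j, order_ge 1 ((fmap_id n K + N) 0 j).
Proof.
move=> N0 j; apply/order_geP => m; rewrite ltnS leqn0 mdeg_eq0 => /eqP ->.
have /order_geP/(_ 0%MM) Nj0 := N0 j; rewrite !mxE /= Nj0 ?mdeg0 // addr0.
by rewrite eq_sym; case: eqP => // /(congr1 mdeg); rewrite mdeg1 mdeg0.
Qed.

(* Truncating [N 0 i] to a polynomial makes [N_i(z + T N(z))] a polynomial in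
   [T]: its values at the natural numbers are fixed by the hypothesis, and its
   derivative at [T = 0] is the left-hand side. *)
Lemma derivation_fixed_shift (N : 'rV[mseries n K]_n) (i : 'I_n) :
  (forall j, order_ge 1 (N 0 j)) ->
  fmap_comp N (fmap_id n K + N) = N ->
  \sum_j N 0 j * msderiv j (N 0 i) = 0.
Proof.
move=> N0 NG; set G := fmap_id n K + N in NG.
have Nfix j : mssubst (N 0 j) G = N 0 j by rewrite -[in RHS]NG mxE.
have G0 := order_ge_shift N0.
have Gvar j : mssubst (msvar K j) G = msvar K j + N 0 j.
  by rewrite -mspolyX mssubst_mspoly // /mseval mmapX mmap1U /G !mxE mspolyX.
pose g : {rmorphism mseries n K -> mseries n K} :=
  HB.pack (fun f => mssubst f G)
    (GRing.isAdditive.Build _ _ _ (mssubst_is_additive G0))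
    (GRing.isMultiplicative.Build _ _ _ (mssubst_is_multiplicative G0)).
(* The map [z + k N(z)]. Since [N] is fixed by substitution of [G], substituting [G] turns it into
   [z + (k + 1) N(z)]. *)
pose Gk k := \row_j (msvar K j + N 0 j *+ k).
have gGk k p : g (mseval (Gk k) p) = mseval (Gk k.+1) p.
  rewrite /mseval rmorph_mmap; rewrite /mmap; apply: eq_bigr => m _;
    congr (_ * _).
    rewrite -[LHS]/(mssubst (mspoly _) G) mssubst_mspoly //.
    by rewrite /mseval mmapC.
  apply: eq_bigr => j _; congr (_ ^+ _).
  by rewrite [LHS]/= !mxE -[LHS]/(g (_ + _)) rmorphD rmorphMn /= Nfix Gvar
    mulrS addrA.
apply: eqms_eq => d; pose p := mstrunc d.+1 (N 0 i).
have tN : eqms d.+1 (N 0 i) (mspoly p) by apply: eqms_trunc.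
have fixN k : eqms d.+1 (mseval (Gk k) p) (N 0 i).
  elim: k => [|k IHk].
    have -> : Gk 0%N = fmap_id n K by apply/rowP => j; rewrite !mxE addr0.
    by rewrite mseval_id; apply: eqms_sym.
  by rewrite -gGk -[X in eqms _ _ X]Nfix; apply: mssubst_local.
have dN : eqms d (\sum_j N 0 j * msderiv j (N 0 i))
    (\sum_j N 0 j * mspoly p^`M(j)).
  apply: big_ind2 => //; first by move=> *; apply: eqmsD.
  move=> j _; apply: eqmsM => //; rewrite -mderiv_mspoly.
  exact: eqms_deriv.
apply: eqms_trans dN _.
have -> : \sum_j N 0 j * mspoly p^`M(j) =
    \sum_j N 0 j * mmap (msconst n K) (fmap_id n K 0) p^`M(j).
  by apply: eq_bigr => j _; rewrite -mseval_id.
rewrite -deriv_mmap_line; set r := mmap _ _ _ => m lt_md.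
have rk k : mscoef r.[k%:R] m = mscoef (N 0 i) m.
  rewrite -(fixN k); last exact: leqW.
  congr (mscoef _ m); rewrite -[LHS]/(horner_eval k%:R r) rmorph_mmap /=.
  rewrite /mseval /mmap; apply: eq_bigr => m' _; congr (_ * _).
    by rewrite /= /horner_eval hornerC.
  apply: eq_bigr => j _; congr (_ ^+ _).
  by rewrite /= /horner_eval !hornerE !mxE mulr_natr.
(* Extracting the coefficient at [m] is only additive, but it commutes with evaluation at [k%:R],
   which merely takes integer multiples. This yields a polynomial over [K], constant on the
   naturals. *)
pose s := \poly_(l < size r) mscoef r`_l m.
have /poly_const_on_nat sC k : s.[k%:R] = mscoef (N 0 i) m.
  rewrite -(rk k) horner_poly horner_coef mscoef_sum; apply: eq_bigr => l _.
  by rewrite -!natrX !mulr_natr mscoefMn.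
have -> : r^`().[0] = r`_1 by rewrite horner_coef0 coef_deriv.
have : s`_1 = 0 by rewrite sC coefC.
rewrite coef_poly; case: ltnP => // le_r _.
by rewrite nth_default.
Qed.

Lemma isotropic_hessian_nilpotent f : laplacian f = 0 ->
  \sum_j msderiv j f ^+ 2 = 0 -> hessian_nilpotent f.
Proof.
move=> lap0 iso; pose H := hessian f.
(* Half the gradient of the isotropy relation: [H grad f = 0]. *)
have HN i : \sum_j msderiv j f * msderiv j (msderiv i f) = 0.
  apply: (@mseries_torsion_free _ 1); rewrite -sumrMnl.
  have /(congr1 (msderiv i)) := iso; rewrite raddf0 raddf_sum /= => diff;
    rewrite -[RHS]diff.
  apply: eq_bigr => j _.
  by rewrite expr2 msderivM (msderivC i j) [X in _ = X + _]mulrC mulr2n.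
pose D (g : mseries n K) := \sum_j msderiv j f * msderiv j g.
have DD : additive D.
  by move=> g h; rewrite /D -sumrB; apply: eq_bigr => j _;
    rewrite raddfB mulrBr.
have DM g h : D (g * h) = D g * h + g * D h.
  rewrite /D mulr_suml mulr_sumr -big_split /=; apply: eq_bigr => j _.
  by rewrite msderivM mulrDr -mulrA (mulrCA g).
pose Da : {additive mseries n K -> mseries n K} :=
  HB.pack D (GRing.isAdditive.Build _ _ _ DD).
have Dmx A B : map_mx D (A *m B) = map_mx D A *m B + A *m map_mx D B :> 'M_n.
  apply/matrixP => i j; rewrite !mxE -[LHS]/(Da _) raddf_sum -big_split /=.
  by apply: eq_bigr => k _; rewrite DM !mxE.
have DH : map_mx D H = - (H *m H).
  apply/matrixP => i j; rewrite !mxE; apply/eqP; rewrite -addr_eq0; apply/eqP.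
  have /(congr1 (msderiv i)) := HN j; rewrite raddf0 raddf_sum /= => diff;
    rewrite -[RHS]diff.
  rewrite /D -big_split /=; apply: eq_bigr => k _; rewrite !mxE msderivM addrC.
  by rewrite (msderivC i k (msderiv j f)).
(* The usual power rule applies because [D H = - H^2] commutes with [H]. *)
have DHX k : map_mx D (H ^+ k.+1) = - (H ^+ k.+2 *+ k.+1).
  elim: k => [|k IHk]; first by rewrite DH.
  rewrite exprS Dmx IHk DH mulNmx mulmxN [in RHS]mulrS opprD; congr (- _ - _).
    by rewrite -mulmxA [RHS]exprS [in RHS]exprS.
  by rewrite [in RHS]exprS -[RHS](mulrnAr H).
exists n; apply: traceless_nilpotent => [g k|k];
  first exact: mseries_torsion_free.
elim: k => [|k IHk].
  by rewrite expr1 -[RHS]lap0 /mxtrace; apply: eq_bigr => i _; rewrite mxE.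
(* Applying [D] to the vanishing trace of [H ^+ k.+1] gives [k + 1] times the next trace, up to
   sign. *)
apply: (@mseries_torsion_free _ k); apply/eqP.
rewrite -oppr_eq0 -raddfMn -raddfN /= -DHX.
have -> : \tr (map_mx D (H ^+ k.+1)) = D (\tr (H ^+ k.+1)).
  by rewrite /mxtrace -[RHS]/(Da _) raddf_sum; apply: eq_bigr => i _;
    rewrite mxE.
by rewrite IHk -[D 0]/(Da 0) raddf0.
Qed.

Lemma msderivX i P k : msderiv i (P ^+ k) = P ^+ k.-1 * msderiv i P *+ k.
Proof.
elim: k => [|k IHk].
  rewrite expr0; apply: (addrI (msderiv i 1)).
  by rewrite -{3}[1]mulr1 msderivM mulr1 mul1r addr0.
rewrite exprS msderivM IHk /= mulrS mulrC; congr (_ + _).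
by case: k {IHk} => [|k]; rewrite ?mulr0n ?mulr0 // mulrnAr mulrA -exprS.
Qed.

Lemma self_inverting_isotropic P :
  self_inverting P -> \sum_j msderiv j P ^+ 2 = 0.
Proof.
case=> oP _ [_ [FG _]]; pose N := gradient P.
have N0 j : order_ge 1 (N 0 j).
  apply/order_geP => m; rewrite ltnS leqn0 mdeg_eq0 => /eqP ->.
  have /order_geP oP0 := oP.
  by rewrite mxE /= oP0 ?mul0rn // mdegD mdeg0 mdeg1.
have G0 := order_ge_shift N0.
(* Componentwise, [F(G(z)) = z] reads [z + N(z) - N(z + N(z)) = z]. *)
have NG : fmap_comp N (fmap_id n K + N) = N.
  apply/rowP => j; have /rowP/(_ j) := FG; rewrite mxE [X in mssubst X _]mxE.
  rewrite [X in mssubst (_ + X) _]mxE (mssubst_is_additive G0) !mxE.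
  rewrite -mspolyX mssubst_mspoly // /mseval mmapX mmap1U !mxE mspolyX.
  move=> e; apply/esym/eqP; rewrite -subr_eq0; apply/eqP.
  by apply: (addrI (msvar K j)); rewrite addrA addr0.
(* The gradient of [<N, N>] is [2 H N = 0], and its constant term vanishes because [N] has order at
   least 1. *)
apply: msderiv_eq0 => [i|].
  have := derivation_fixed_shift i N0 NG => /(congr1 (fun g => g *+ 2)).
  rewrite mul0rn -sumrMnl raddf_sum /= => DN; rewrite -[RHS]DN.
  by apply: eq_bigr => j _;
    rewrite !mxE expr2 msderivM (msderivC i j) mulrC mulr2n.
rewrite mscoef_sum big1 // => j _.
have /order_geP/(_ 0%MM) := order_geX (k := 2) (N0 j).
by rewrite mdeg0 mxE; apply.
Qed.

Lemma isotropic_harmonicX P k :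
  laplacian P = 0 -> \sum_j msderiv j P ^+ 2 = 0 -> laplacian (P ^+ k) = 0.
Proof.
move=> lap0 iso.
(* The expansion [k (k-1) P^(k-2) <grad P, grad P> + k P^(k-1) Delta P], summand by summand. For
   [k < 2] the truncated exponents are harmless, since their integer factors are zero. *)
rewrite /laplacian (eq_bigr (fun j =>
  P ^+ k.-2 *+ k.-1 *+ k * msderiv j P ^+ 2 +
  P ^+ k.-1 *+ k * msderiv j (msderiv j P))); last first.
  move=> j _; rewrite msderivX raddfMn /= msderivM msderivX mulrnDl expr2.
  by rewrite !mulrA !mulrnAl.
by rewrite big_split /= -!mulr_sumr iso mulr0 add0r -[X in _ * X]/(laplacian P)
  lap0 mulr0.
Qed.

Lemma isotropicX P k :
  \sum_j msderiv j P ^+ 2 = 0 -> \sum_j msderiv j (P ^+ k) ^+ 2 = 0.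
Proof.
move=> iso;
  rewrite -[RHS](mulr0 ((P ^+ k.-1 *+ k) ^+ 2)) -[X in _ = _ * X]iso mulr_sumr.
by apply: eq_bigr => j _; rewrite msderivX -exprMn mulrnAl.
Qed.

End Char0.

Theorem proposition4p6 (R : realType) (n : nat) (P : mseries n R[i])
    (hharm : harmonic P) (hself : self_inverting P) (m : nat) (hm : (1 <= m)%N) :
  hessian_nilpotent (P ^+ m).
Proof.
have iso := self_inverting_isotropic hself.
apply: isotropic_hessian_nilpotent; first exact: isotropic_harmonicX.
exact: isotropicX.
Qed.
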